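(* Let $q\in\mathbb{C}$ with $0<|q|<1$, and consider the degree $25$ $q$-difference equation $$\Big[(1-q^{Q\partial_Q})^5-Q\prod_{k=1}^5\big(1-q^{k}q^{5Q\partial_Q}\big)\Big]I=0 .\qquad(\ast)$$ Put $z=Q^{1/20}$, $p=q^{1/20}$, $\sigma_p=p^{z\partial_z}$. The exceptional $20$ solutions of $(\ast)$ at $Q=0$ are given as follows: for each $20$th root of unity $\xi$ there is a (nonzero, formal) solution of $(\ast)$ of the form $$\theta_p(z)\,e_{p,\xi p^{-1/2}}(z)\,F(z)=\theta_p(z)\,e_{p,\xi p^{-1/2}}(z)\sum_{n\ge 0}f_nz^n ,$$ where the formal power series $F(z)=\sum_{n\ge0}f_nz^n$ satisfies $$\Big[\big(z-\xi p^{-\frac92}\sigma_p\big)\big(z-\xi p^{-\frac72}\sigma_p\big)\big(z-\xi p^{-\frac52}\sigma_p\big)\big(z-\xi p^{-\frac32}\sigma_p\big)\big(z-\xi p^{-\frac12}\sigma_p\big)$$ $$-\big(z^5-\xi^5p^{-\frac{25}2}\sigma_p^5\big)\big(z^5-\xi^5p^{-\frac{15}2}\sigma_p^5\big)\big(z^5-\xi^5p^{-\frac52}\sigma_p^5\big)\big(z^5-\xi^5p^{\frac52}\sigma_p^5\big)\big(z^5-\xi^5p^{\frac{15}2}\sigma_p^5\big)\Big]F(z)=0 .$$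
   Context: $q^{Q\partial_Q}$ is the operator $f(Q)\mapsto f(qQ)$; $q^{5Q\partial_Q}$ is its fifth power. A choice of $p^{1/2}$ with $(p^{1/2})^{40}=q$ is fixed, and $p=(p^{1/2})^2$. In the variable $z=Q^{1/20}$ (so $Q=z^{20}$), $q^{Q\partial_Q}$ acts as $\sigma_p:f(z)\mapsto f(pz)$. Products of operators are noncommutative products (compositions), with $\sigma_p z=pz\,\sigma_p$. $\theta_p(z)=\sum_{d\in\mathbb{Z}}p^{d(d-1)/2}z^d$ is Jacobi's theta function, satisfying $\sigma_p\theta_p(z)=z^{-1}\theta_p(z)$. For $\lambda\in\mathbb{C}^*$, $e_{p,\lambda}(z)=\theta_p(z)/\theta_p(\lambda z)$, satisfying $\sigma_p e_{p,\lambda}=\lambda e_{p,\lambda}$. ''Formal solution'' means: the operators act on expressions $\theta_p(z)e_{p,\lambda}(z)F(z)$, $F\in\mathbb{C}[[z]]$, via $\sigma_p(\theta_p e_{p,\lambda}F)=z^{-1}\lambda\,\theta_p e_{p,\lambda}\,F(pz)$; no convergence of $F$ is claimed. ''Exceptional'' refers to the solutions other than the $5$ solutions obtained from the root $x=1$ (of multiplicity $5$) of the characteristic equation $(1-x)^5=0$ of $(\ast)$ at $Q=0$. *)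

(* Defs.v *)
From HB Require Import structures.
From mathcomp Require Import all_boot all_order all_algebra.
From mathcomp Require Import complex functions reals.

Set Implicit Arguments.
Unset Strict Implicit.
Unset Printing Implicit Defensive.

Import GRing.Theory.

Local Open Scope ring_scope.

(* The left-hand side of the degree 25 equation, for any space V on which
   Q acts by [Qm] and q^{Q d/dQ} acts by [sg].  The operator product is a
   composition. *)
Definition qde_op (C : fieldType) (V : lmodType C) (q : C)
    (Qm sg : V -> V) (I : V) : V :=
  iter 5 (fun J => J - sg J) I
  - Qm ((\big[comp/idfun]_(1 <= k < 6) (fun J => J - q ^+ k *: iter 5 sg J)) I).

(* C[[z]]: [F n] is the coefficient of z^n. *)
Definition fps (C : fieldType) : Type := nat -> C^o.
HB.instance Definition _ (C : fieldType) :=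
  GRing.Lmodule.copy (fps C) (nat -> C^o).

Definition fps_mulz (C : fieldType) (F : fps C) : fps C :=
  fun n => if n is m.+1 then F m else 0.

(* F(z) |-> F(pz) *)
Definition fps_sigma (C : fieldType) (p : C) (F : fps C) : fps C :=
  fun n => p ^+ n * F n.

(* [G : theta_expr lambda] stands for the expression
   theta_p(z) e_{p,lambda}(z) sum_{n in Z} G_n z^n.  The operators z^{+-1} and
   sigma_p shift or rescale coefficients, so they make sense without a lower
   bound on the support; starting from F in C[[z]] they only produce Laurent
   series.  Here theta_p(z) = sum_d p^(d(d-1)/2) z^d and
   e_{p,lambda}(z) = theta_p(z) / theta_p(lambda z) enter as symbols, only
   through sigma_p theta_p = z^-1 theta_p and
   sigma_p e_{p,lambda} = lambda e_{p,lambda}. *)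
Definition theta_expr (C : fieldType) (lambda : C) : Type := int -> C^o.
HB.instance Definition _ (C : fieldType) (lambda : C) :=
  GRing.Lmodule.copy (theta_expr lambda) (int -> C^o).

(* theta_p e_{p,lambda} F *)
Definition theta_e (C : fieldType) (lambda : C) (F : fps C) :
    theta_expr lambda :=
  fun n => if n is Posz m then F m else 0.

Definition theta_mulz (C : fieldType) (lambda : C) (G : theta_expr lambda) :
    theta_expr lambda :=
  fun n => G (n - 1).

(* sigma_p (theta_p e_{p,lambda} G(z)) = theta_p e_{p,lambda} z^-1 lambda G(pz):
   the coefficient of z^n in z^-1 G(pz) is p^(n+1) G_{n+1}. *)
Definition theta_sigma (C : fieldType) (p lambda : C)
    (G : theta_expr lambda) : theta_expr lambda :=
  fun n => lambda * (p ^ (n + 1) * G (n + 1)).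

(* theta_p e_{p,lambda} F is a formal solution; Q = z^20 and q^{Q d/dQ} acts as
   sigma_p. *)
Definition formal_solution (C : fieldType) (q p lambda : C) (F : fps C) : Prop :=
  qde_op q (iter 20 (@theta_mulz C lambda)) (@theta_sigma C p lambda)
    (theta_e lambda F) = 0.

(* z^k - c sigma_p^k on C[[z]] *)
Definition zsfac (C : fieldType) (p : C) (k : nat) (c : C) (F : fps C) : fps C :=
  iter k (@fps_mulz C) F - c *: iter k (fps_sigma p) F.

(* The degree 25 operator on F; [s] is p^{1/2}, so s ^- 9 is p^{-9/2}. *)
Definition series_op (C : fieldType) (s xi : C) (F : fps C) : fps C :=
  let p := s ^+ 2 in
  (zsfac p 1 (xi * s ^- 9) \o zsfac p 1 (xi * s ^- 7)
     \o zsfac p 1 (xi * s ^- 5) \o zsfac p 1 (xi * s ^- 3)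
     \o zsfac p 1 (xi * s ^- 1)) F
  - (zsfac p 5 (xi ^+ 5 * s ^- 25) \o zsfac p 5 (xi ^+ 5 * s ^- 15)
     \o zsfac p 5 (xi ^+ 5 * s ^- 5) \o zsfac p 5 (xi ^+ 5 * s ^+ 5)
     \o zsfac p 5 (xi ^+ 5 * s ^+ 15)) F.

(* Main.v *)
Require Import Defs.
From mathcomp Require Import all_boot all_order all_algebra.
From mathcomp Require Import complex functions reals boolp.
From mathcomp Require Import ring.

Set Implicit Arguments.
Unset Strict Implicit.
Unset Printing Implicit Defensive.

Import Order.TTheory GRing.Theory Num.Theory.

Local Open Scope ring_scope.
Local Open Scope complex_scope.

(** Write Z for multiplication by z, S for the action of sigma_p on expressions
    theta_p e_{p,lambda} G, and sigma for the plain G(z) |-> G(pz).  The factor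
    theta_p makes S equal to lambda z^-1 sigma, so Z S = lambda sigma: one power
    of Z removes the negative power of z hidden in each S.  The equation has
    degree 5 in S on one side, and Q = Z^20 times degree 25 in S on the other.
    Multiplying it by Z^5 therefore clears all negative powers at once, and the
    commutation Z sigma = p^-1 sigma Z spreads Z^5 and Z^25 over the factors:
<<
      Z^5  (1 - S)^5                  becomes  prod_i (z - lambda p^-i sigma),
      Z^25 prod_k (1 - q^k S^5)       becomes  prod_j (z^5 - lambda^5 p^(5j-10) sigma^5),
>>
    with i and j running over 0..4.  As Z is injective, being a formal solution
    is equivalent to being killed by the difference of these two products
    ([formal_solution_recurrence]), and lambda = xi p^(-1/2) gives the operator
    of the theorem ([series_op_recurrence]).

    On coefficients this operator is lower triangular, with n-th diagonal entry
    a nonzero multiple of (lambda p^n)^20 p^10 - 1 ([triangular_recurrence]).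
    For lambda = xi p^(-1/2) with xi^20 = 1 that entry vanishes at n = 0, and it
    vanishes at no n > 0, because p is not a root of unity.  The recurrence can
    thus be solved from f_0 = 1, with a unique answer ([triangular_solution],
    [triangular_inj]).

    Conversely, dividing a nonzero solution by the power z^n that it starts with
    replaces lambda by lambda p^n ([recurrence_op_mulz]) and leaves a nonzero
    constant term.  The diagonal entry at 0 must then vanish, so
    xi = lambda p^n p^(1/2) is a 20th root of unity, and uniqueness makes the
    quotient a multiple of the solution already found.  The exponent n is the
    valuation of the given series, hence xi is determined by it. *)

(** * Lower triangular operators on power series *)

(** Lower triangularity with diagonal [d] is phrased through pairs of series
    that agree below [n]: in this form it passes to compositions without any
    expansion of the operators into coefficients. *)

Record triangular (C : fieldType) (d : nat -> C) (L : fps C -> fps C) : Prop :=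
  Triangular {
    triangularZ : forall (c : C) (F : fps C), L (c *: F) = c *: L F;
    triangular_diag : forall (F G : fps C) n, (forall m, (m < n)%N -> F m = G m) ->
      L F n - L G n = d n * (F n - G n) }.

Section Triangular.
Variable C : fieldType.
Implicit Types (p c : C) (d e : nat -> C) (L M : fps C -> fps C) (F G H : fps C).

Lemma eq_triangular d e L : d =1 e -> triangular d L -> triangular e L.
Proof. by move=> /funext ->. Qed.

Lemma triangular_comp d e L M : triangular d L -> triangular e M ->
  triangular (fun n => d n * e n) (L \o M).
Proof.
move=> tL tM; split=> [c F|F G n eqFG] /=.
  by rewrite (triangularZ tM) (triangularZ tL).
rewrite (triangular_diag tL) => [|m ltmn].
  by rewrite (triangular_diag tM) // mulrA.
apply/eqP; rewrite -subr_eq0 (triangular_diag tM) => [|k ltkm].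
  by rewrite eqFG // subrr mulr0.
exact/eqFG/(ltn_trans ltkm).
Qed.

Lemma triangular_sub d e L M : triangular d L -> triangular e M ->
  triangular (fun n => d n - e n) (fun F => L F - M F).
Proof.
move=> tL tM; split=> [c F|F G n eqFG] /=.
  by rewrite (triangularZ tM) (triangularZ tL) scalerBr.
rewrite mulrBl -(triangular_diag tL eqFG) -(triangular_diag tM eqFG).
have subE (X Y : fps C) : (X - Y) n = X n - Y n by [].
by rewrite !subE; ring.
Qed.

Lemma triangular0 d L : triangular d L -> L 0 = 0.
Proof. by move=> tL; rewrite -(scale0r (0 : fps C)) (triangularZ tL) !scale0r. Qed.

Lemma triangular_head d L F n : triangular d L ->
  (forall m, (m < n)%N -> F m = 0) -> L F n = d n * F n.
Proof.
move=> tL F0; have := triangular_diag tL (G := 0) F0.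
by rewrite (triangular0 tL) !subr0.
Qed.

Lemma triangular_inj d L F G : triangular d L ->
  (forall n, (0 < n)%N -> d n != 0) -> L F = L G -> F 0%N = G 0%N -> F = G.
Proof.
move=> tL d_neq0 eqL eq0; apply/funext => n.
elim/ltn_ind: n => -[|n] IHn //.
have := triangular_diag tL IHn; rewrite eqL subrr => /esym/eqP.
by rewrite mulf_eq0 (negbTE (d_neq0 n.+1 _)) //= subr_eq0 => /eqP.
Qed.

(** Start from the series 1 and, at step [n], change only the coefficient of
    index [n] so that the [n]-th coefficient of the image vanishes; later
    changes cannot disturb it, and the diagonal of the steps is the solution. *)
Lemma triangular_solution d L : triangular d L ->
  d 0%N = 0 -> (forall n, (0 < n)%N -> d n != 0) ->
  exists F, F 0%N = 1 /\ L F = 0.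
Proof.
move=> tL d0 d_neq0.
pose upd (G : fps C) n : fps C :=
  fun m => if m == n then G n - L G n / d n else G m.
pose approx := fix approx n : fps C :=
  if n is n'.+1 then upd (approx n') n else fun m => (m == 0%N)%:R.
have approx_stable n k : approx (n + k)%N n = approx n n.
  elim: k => [|k IHk]; first by rewrite addn0.
  by rewrite addnS /= /upd ltn_eqF // ltnS leq_addr.
exists (fun n => approx n n); split=> //; apply/funext => -[|n].
  by rewrite (triangular_head tL) // d0 mul0r.
have /(triangular_diag tL) : forall m, (m < n.+1)%N -> approx m m = approx n m.
  by move=> m lemn; rewrite -(subnKC (n := n) (m := m)) ?approx_stable.
rewrite /= /upd eqxx addrAC subrr add0r mulrN mulrCA divff ?d_neq0 // mulr1.
by move/(canRL (subrK _)); rewrite addNr.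
Qed.

Lemma iter_mulzZ k c F : c *: iter k (@fps_mulz C) F = iter k (@fps_mulz C) (c *: F).
Proof.
elim: k => //= k <-; apply/funext => -[|n] //.
by rewrite -[LHS]/(c * 0) mulr0.
Qed.

Lemma iter_mulzE k F n :
  iter k (@fps_mulz C) F n = if (k <= n)%N then F (n - k)%N else 0.
Proof. by elim: k n => [|k IHk] [|n] //=; rewrite IHk. Qed.

Lemma iter_sigmaE p k F n : iter k (fps_sigma p) F n = (p ^+ n) ^+ k * F n.
Proof. by elim: k => [|k IHk] /=; rewrite ?mul1r // /fps_sigma IHk mulrA -exprS. Qed.

Lemma zsfacE p k c F n : zsfac p k c F n =
  (if (k <= n)%N then F (n - k)%N else 0) - c * ((p ^+ n) ^+ k * F n).
Proof. by rewrite -iter_mulzE -iter_sigmaE. Qed.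

Lemma triangular_zsfac p k c : (0 < k)%N ->
  triangular (fun n => - (c * (p ^+ n) ^+ k)) (zsfac p k c).
Proof.
move=> k_gt0; split=> [a F|F G n eqFG].
  apply/funext => n; have scaleE (X : fps C) m : (a *: X) m = a * X m by [].
  by rewrite scaleE !zsfacE scaleE; case: ifP; rewrite ?scaleE => _; ring.
rewrite !zsfacE; case: leqP => [le_kn|_]; last by ring.
rewrite eqFG; first by ring.
by rewrite ltn_subrL k_gt0 (leq_trans k_gt0).
Qed.

(** This is sigma z = p z sigma, taken [k] times. *)
Lemma zsfac_mulz p k c F :
  zsfac p k c (fps_mulz F) = fps_mulz (zsfac p k (c * p ^+ k) F).
Proof.
have subE (X Y : fps C) n : (X - Y) n = X n - Y n by [].
have scaleE a (X : fps C) n : (a *: X) n = a * X n by [].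
apply/funext => n; rewrite /zsfac subE scaleE iter_sigmaE -iterSr /fps_mulz.
case: n => [|n] /=; first by rewrite !mulr0 subr0.
by rewrite subE scaleE iter_sigmaE exprS exprMn; ring.
Qed.

Lemma fps_valuation G : G <> 0 ->
  exists n H, G = iter n (@fps_mulz C) H /\ H 0%N != 0.
Proof.
move=> G_neq0; have [n Gn] : exists n, G n != 0.
  apply/not_existsP => G0; apply: G_neq0; apply/funext => n.
  by have /negP/negPn/eqP := G0 n.
exists (ex_minn (ex_intro (fun k => G k != 0) n Gn)); case: ex_minnP => m Gm m_min.
exists (fun k => G (k + m)%N); split=> //; apply/funext => k.
rewrite iter_mulzE; case: leqP => [le_mk|lt_km]; first by rewrite subnK.
by apply/eqP; apply: contraLR lt_km; rewrite -leqNgt; exact: m_min.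
Qed.

Lemma valuation_inj F G m n :
  F 0%N != 0 -> G 0%N != 0 ->
  iter m (@fps_mulz C) F = iter n (@fps_mulz C) G -> m = n.
Proof.
wlog le_mn : m n F G / (m <= n)%N => [hwlog|F0 _ eqFG].
  case/orP: (leq_total m n) => [|le_nm F0 G0 eqFG]; first exact: hwlog.
  by apply/esym/(hwlog _ _ G F).
apply/eqP; rewrite eqn_leq le_mn leqNgt; apply: contra_neqN F0 => lt_mn.
have := congr1 (@^~ m) eqFG; rewrite /= !iter_mulzE leqnn subnn.
by rewrite leqNgt lt_mn.
Qed.

End Triangular.

(** * Clearing the negative powers of z *)

(** The composition takes the factor of index 1 last, whereas spreading powers
    of z over the factors yields the exponents of the target operator only if
    the factor of index 5 comes last. *)
Lemma big_comp_rev (T : Type) (E : nat -> T -> T) x :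
  (forall i j y, E i (E j y) = E j (E i y)) ->
  (\big[comp/idfun]_(1 <= k < 6) E k) x = E 5 (E 4 (E 3 (E 2 (E 1 x)))).
Proof.
move=> EC; rewrite 5?big_ltn // big_geq //=.
rewrite (EC 1 2) (EC 1 3) (EC 1 4) (EC 1 5).
by rewrite (EC 2 3) (EC 2 4) (EC 2 5) (EC 3 4) (EC 3 5) (EC 4 5).
Qed.

Section Clear.
Variables (C : fieldType) (p lambda : C).
Hypothesis p_neq0 : p != 0.
Implicit Types (G H : theta_expr lambda) (F : fps C).

Let Z := @theta_mulz C lambda.
Let S := @theta_sigma C p lambda.

(** The shift [G(z) |-> G(pz)] on the series factor alone, that is, the operator
    sigma_p stripped of its effect on theta_p e_{p,lambda}. *)
Definition laurent_sigma G : theta_expr lambda := fun n => p ^ n * G n.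

Definition laurent_zsfac k (c : C) G : theta_expr lambda :=
  iter k Z G - c *: iter k laurent_sigma G.

Lemma theta_mulz_inj : injective Z.
Proof.
move=> G H eqZ; apply/funext => n; move/(congr1 (fun X => X (n + 1))): eqZ.
by rewrite /Z /theta_mulz addrK.
Qed.

Lemma theta_mulzZ c G : Z (c *: G) = c *: Z G. Proof. by []. Qed.

Lemma iter_theta_mulzB m G H : iter m Z (G - H) = iter m Z G - iter m Z H.
Proof. by elim: m => //= m ->. Qed.
Lemma iter_theta_mulzZ m c G : iter m Z (c *: G) = c *: iter m Z G.
Proof. by elim: m => //= m ->. Qed.

Lemma laurent_sigmaZ c G : laurent_sigma (c *: G) = c *: laurent_sigma G.
Proof. by apply/funext => n; exact: mulrCA. Qed.

Lemma theta_sigmaZ c G : S (c *: G) = c *: S G.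
Proof.
apply/funext => n; rewrite /S /theta_sigma.
have scaleE X m : (c *: X : theta_expr lambda) m = c * X m by [].
by rewrite !scaleE; ring.
Qed.

Lemma theta_sigmaB G H : S (G - H) = S G - S H.
Proof.
apply/funext => n; rewrite /S /theta_sigma.
have subE (X Y : theta_expr lambda) m : (X - Y) m = X m - Y m by [].
by rewrite !subE; ring.
Qed.

(** The relation on which everything rests: the action of sigma_p on theta_p
    costs exactly one z^-1. *)
Lemma mulz_theta_sigma G : Z (S G) = lambda *: laurent_sigma G.
Proof. by apply/funext => n; rewrite /Z /theta_mulz /S /theta_sigma subrK. Qed.

Lemma mulz_laurent_sigma G : Z (laurent_sigma G) = p^-1 *: laurent_sigma (Z G).
Proof.
apply/funext => n; have scaleE c X m : (c *: X : theta_expr lambda) m = c * X m by [].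
by rewrite scaleE /Z /theta_mulz /laurent_sigma expfzDr // mulrA [p^-1 * _]mulrC.
Qed.

Lemma iter_mulz_sigma m k G : iter m Z (iter k laurent_sigma G) =
  p ^- (k * m) *: iter k laurent_sigma (iter m Z G).
Proof.
have Z_iter k' H : Z (iter k' laurent_sigma H) =
    p ^- k' *: iter k' laurent_sigma (Z H).
  elim: k' => [|k' IHk] /=; first by rewrite invr1 scale1r.
  rewrite mulz_laurent_sigma IHk laurent_sigmaZ scalerA.
  by rewrite exprS invfM.
elim: m => [|m IHm] /=; first by rewrite muln0 invr1 scale1r.
by rewrite IHm theta_mulzZ Z_iter scalerA mulnS exprD invfM mulrC.
Qed.

Lemma iter_mulz_theta_sigma k G : iter k Z (iter k S G) =
  (lambda ^+ k / p ^+ 'C(k, 2)) *: iter k laurent_sigma G.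
Proof.
elim: k => [|k IHk]; first by rewrite bin0n /= divr1 scale1r.
rewrite iterSr iterS mulz_theta_sigma iter_theta_mulzZ.
rewrite (iter_mulz_sigma k 1) IHk !scalerA -/(iter 1 _ _) /= laurent_sigmaZ scalerA.
by rewrite binS bin1 mul1n exprS exprD invfM; congr (_ *: _); ring.
Qed.

(** The first [k] of the powers of Z turn the factor into an operator on power
    series, at the price of p^-(0 + 1 + ... + (k-1)); moving the other [m] to
    its right costs p^-(k m). *)
Lemma clear_factor k m c G :
  iter (m + k) Z (G - c *: iter k S G) =
  laurent_zsfac k (c * lambda ^+ k / p ^+ ('C(k, 2) + k * m)) (iter m Z G).
Proof.
rewrite iterD !iter_theta_mulzB !iter_theta_mulzZ iter_mulz_theta_sigma.
rewrite iter_theta_mulzZ iter_mulz_sigma !scalerA /laurent_zsfac -iterD addnC iterD.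
by rewrite exprD invfM !mulrA.
Qed.

Lemma theta_e_inj : injective (@theta_e C lambda).
Proof. by move=> F F' eqF; apply/funext => n; have := congr1 (@^~ (Posz n)) eqF. Qed.

Lemma theta_e0 : theta_e lambda 0 = 0.
Proof. by apply/funext => -[]. Qed.

Lemma theta_eB F F' :
  theta_e lambda (F - F') = theta_e lambda F - theta_e lambda F'.
Proof. by apply/funext => -[n|n] //; rewrite /= -[LHS](subrr 0). Qed.

Lemma theta_e_zsfac k c F :
  theta_e lambda (zsfac p k c F) = laurent_zsfac k c (theta_e lambda F).
Proof.
have theta_eZ a (H : fps C) : theta_e lambda (a *: H) = a *: theta_e lambda H.
  by apply/funext => -[n|n] //; rewrite -[LHS](mulr0 a).
have theta_e_mulz (H : fps C) : theta_e lambda (fps_mulz H) = Z (theta_e lambda H).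
  apply/funext => -[[|n]|n] //.
  by rewrite /Z /theta_mulz intS addrAC subrr add0r.
have theta_e_sigma (H : fps C) :
    theta_e lambda (fps_sigma p H) = laurent_sigma (theta_e lambda H).
  by apply/funext => -[n|n] //; rewrite /laurent_sigma mulr0.
rewrite theta_eB theta_eZ /laurent_zsfac; congr (_ - _ *: _).
  by elim: k => //= k IHk; rewrite theta_e_mulz IHk.
by elim: k => //= k IHk; rewrite theta_e_sigma IHk.
Qed.

(** The operator on F obtained from the equation for arbitrary [lambda]; keeping
    [lambda] free is what allows a factor z^n to be absorbed into it. *)
Definition recurrence_op F : fps C :=
  (zsfac p 1 (lambda / p ^+ 4) \o zsfac p 1 (lambda / p ^+ 3)
     \o zsfac p 1 (lambda / p ^+ 2) \o zsfac p 1 (lambda / p)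
     \o zsfac p 1 lambda) F
  - (zsfac p 5 (lambda ^+ 5 / p ^+ 10) \o zsfac p 5 (lambda ^+ 5 / p ^+ 5)
     \o zsfac p 5 (lambda ^+ 5) \o zsfac p 5 (lambda ^+ 5 * p ^+ 5)
     \o zsfac p 5 (lambda ^+ 5 * p ^+ 10)) F.

Lemma sigma_factorC k a b G :
  let E (c : C) H := H - c *: iter k S H in E a (E b G) = E b (E a G).
Proof.
have iterSB n H K : iter n S (H - K) = iter n S H - iter n S K.
  by elim: n => //= n ->; rewrite theta_sigmaB.
have iterSZ n c H : iter n S (c *: H) = c *: iter n S H.
  by elim: n => //= n ->; rewrite theta_sigmaZ.
rewrite /= !iterSB !iterSZ !scalerBr !scalerA [a * b]mulrC !opprB !addrA.
by rewrite addrAC [RHS]addrAC; congr (_ + _); rewrite addrAC.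
Qed.

(** In the second product, taken in decreasing order of k, the factor
    1 - q^k S^5 has 5(k - 1) powers of Z left on its right; with q = p^20 its
    coefficient carries p to the exponent 20k - 10 - 25(k - 1) = 15 - 5k. *)
Lemma clear_qde_op q F : q = p ^+ 20 ->
  iter 5 Z (qde_op q (iter 20 Z) S (theta_e lambda F))
  = theta_e lambda (recurrence_op F).
Proof.
move=> qE; rewrite theta_eB iter_theta_mulzB -iterD; congr (_ - _).
  pose D J := J - S J.
  have clear1 m n G : iter m.+1 Z (iter n.+1 D G) =
      laurent_zsfac 1 (lambda / p ^+ m) (iter m Z (iter n D G)).
    rewrite [iter n.+1 _ _]iterS -[m.+1]addn1 /D -[S _]scale1r (clear_factor 1).
    by rewrite mul1r expr1 mul1n.
  rewrite -/D (clear1 4%N 4%N) (clear1 3 3) (clear1 2 2) (clear1 1 1)%N.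
  by rewrite (clear1 0 0)%N !theta_e_zsfac divr1 expr1.
pose E j G := G - q ^+ j *: iter 5 S G.
have clear5 m G j a b : (a + (10 + 5 * m) = 20 * j + b)%N ->
    iter (5 + m) Z (E j G) =
      laurent_zsfac 5 (lambda ^+ 5 * p ^+ a / p ^+ b) (iter m Z G).
  move=> ab; rewrite addnC clear_factor qE -exprM; congr (laurent_zsfac _ _ _).
  apply: (canLR (mulfK _)); first by rewrite expf_neq0.
  rewrite [RHS]mulrAC; apply: (canRL (mulfK _)); first by rewrite expf_neq0.
  by rewrite mulrAC -exprD -mulrA -exprD ab mulrC.
have EC i j G : E i (E j G) = E j (E i G) by exact: sigma_factorC.
have -> : (\big[comp/idfun]_(1 <= k < 6) E k) (theta_e lambda F) =
    E 5 (E 4 (E 3 (E 2 (E 1 (theta_e lambda F))))).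
  exact: big_comp_rev.
(* The last two numbers are the positive and the negative part of the exponent
   of p in the resulting factor. *)
rewrite (clear5 20 _ 5 0 10)%N // (clear5 15 _ 4 0 5)%N //.
rewrite (clear5 10 _ 3 0 0)%N // (clear5 5 _ 2 5 0)%N // (clear5 0 _ 1 10 0)%N //.
by rewrite expr0 !mulr1 !divr1 /= !theta_e_zsfac.
Qed.

Lemma formal_solution_recurrence q F : q = p ^+ 20 ->
  formal_solution q p lambda F <-> recurrence_op F = 0.
Proof.
move=> qE; have iterZ0 m : iter m Z 0 = 0 by elim: m => //= m ->.
rewrite /formal_solution; split=> [eq0|eq0].
  by apply: theta_e_inj; rewrite -(clear_qde_op F qE) eq0 iterZ0 theta_e0.
have := clear_qde_op F qE; rewrite eq0 theta_e0 -(iterZ0 5).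
by do 5!move/theta_mulz_inj.
Qed.

(** The difference of the two products of diagonal entries, lambda^25 p^(25 n)
    and lambda^5 p^(5 n - 10), factored so that its zeros can be read off. *)
Definition indicial n : C :=
  (lambda * p ^+ n) ^+ 5 / p ^+ 10 * ((lambda * p ^+ n) ^+ 20 * p ^+ 10 - 1).

Lemma triangular_recurrence : triangular indicial recurrence_op.
Proof.
have tz k c : (0 < k)%N -> triangular _ (zsfac p k c) := triangular_zsfac p c.
have comp := triangular_comp.
apply: eq_triangular (triangular_sub
  (comp _ _ _ _ _ (comp _ _ _ _ _ (comp _ _ _ _ _ (comp _ _ _ _ _
    (tz 1 (lambda / p ^+ 4) isT) (tz 1 (lambda / p ^+ 3) isT))
    (tz 1 (lambda / p ^+ 2) isT)) (tz 1 (lambda / p) isT)) (tz 1 lambda isT))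
  (comp _ _ _ _ _ (comp _ _ _ _ _ (comp _ _ _ _ _ (comp _ _ _ _ _
    (tz 5 (lambda ^+ 5 / p ^+ 10) isT) (tz 5 (lambda ^+ 5 / p ^+ 5) isT))
    (tz 5 (lambda ^+ 5) isT)) (tz 5 (lambda ^+ 5 * p ^+ 5) isT))
    (tz 5 (lambda ^+ 5 * p ^+ 10) isT))) => n.
by rewrite /indicial; field.
Qed.

(** Leading coefficients can only occur where the diagonal vanishes; with
    [lambda = xi / s] and [p = s ^+ 2] this says that [xi ^+ 20 = 1]. *)
Lemma indicial_eq0 : lambda != 0 ->
  (indicial 0 == 0) = (lambda ^+ 20 * p ^+ 10 == 1).
Proof.
move=> lambda_neq0; rewrite /indicial mulr1 mulf_eq0 subr_eq0.
by rewrite mulf_eq0 invr_eq0 !expf_eq0 /= (negbTE lambda_neq0) (negbTE p_neq0).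
Qed.

(** Absence of resonance: the two zeros of the indicial function at 0 and [n]
    would differ by a factor [p ^+ n] of order dividing 20. *)
Lemma indicial_neq0 n : lambda ^+ 20 * p ^+ 10 = 1 -> (p ^+ n) ^+ 20 != 1 ->
  indicial n != 0.
Proof.
move=> lambda1 pn_neq1; have lambda_neq0 : lambda != 0.
  apply/eqP => lambda0; move/eqP: lambda1.
  by rewrite lambda0 expr0n mul0r eq_sym oner_eq0.
rewrite /indicial; have -> : (lambda * p ^+ n) ^+ 20 * p ^+ 10 = (p ^+ n) ^+ 20.
  by rewrite exprMn mulrAC lambda1 mul1r.
by rewrite !mulf_neq0 ?invr_eq0 ?expf_neq0 ?mulf_neq0 ?expf_neq0 ?subr_eq0.
Qed.

End Clear.

(** * The exceptional solutions *)

(** Reflects the identity z e_{p,lambda} = e_{p,lambda p}, up to a factor that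
    sigma_p fixes. *)
Lemma recurrence_op_mulz (C : fieldType) (p lambda : C) n (F : fps C) : p != 0 ->
  recurrence_op p lambda (iter n (@fps_mulz C) F) =
  iter n (@fps_mulz C) (recurrence_op p (lambda * p ^+ n) F).
Proof.
move=> p_neq0.
have mulzB (X Y : fps C) : fps_mulz (X - Y) = fps_mulz X - fps_mulz Y.
  by apply/funext => -[|m] //; rewrite /= -[LHS](subrr 0).
elim: n lambda => [|n IHn] lambda; first by rewrite mulr1.
rewrite !iterS exprS mulrA -IHn /recurrence_op mulzB /= !zsfac_mulz expr1.
have shift5 c : lambda ^+ 5 * c * p ^+ 5 = (lambda * p) ^+ 5 * c.
  by rewrite exprMn mulrAC.
by rewrite !(mulrAC _ _ p) !shift5 -(exprMn 5 lambda p).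
Qed.

Lemma series_op_recurrence (C : fieldType) (s xi : C) (F : fps C) : s != 0 ->
  series_op s xi F = recurrence_op (s ^+ 2) (xi / s) F.
Proof.
move=> s_neq0; rewrite /series_op /recurrence_op expr1.
have odd_power k : xi / s / (s ^+ 2) ^+ k = xi * s ^- (2 * k).+1.
  by rewrite -exprM exprS invfM mulrA.
have power5 k : (xi / s) ^+ 5 / (s ^+ 2) ^+ k = xi ^+ 5 * s ^- (5 + 2 * k).
  by rewrite exprMn exprVn -exprM -mulrA -invfM -exprD.
have -> : xi / s / s ^+ 2 = xi * s ^- 3 by rewrite (odd_power 1).
rewrite !odd_power !power5.
have -> : (xi / s) ^+ 5 = xi ^+ 5 * s ^- 5 by rewrite exprMn exprVn.
have -> : xi ^+ 5 * s ^- 5 * (s ^+ 2) ^+ 5 = xi ^+ 5 * s ^+ 5 by field.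
have -> : xi ^+ 5 * s ^- 5 * (s ^+ 2) ^+ 10 = xi ^+ 5 * s ^+ 15 by field.
by [].
Qed.

Theorem proposition1p1 (R : realType) (q p s : R[i])
    (hq : 0 < `|q| < 1) (hs : s ^+ 40 = q) (hp : p = s ^+ 2) :
  exists F : R[i] -> fps R[i],
    (forall xi : R[i], xi ^+ 20 = 1 ->
       [/\ F xi <> 0,
           formal_solution q p (xi * s^-1) (F xi)
         & series_op s xi (F xi) = 0])
    /\
    (forall (lambda : R[i]) (G : fps R[i]),
       lambda <> 0 -> G <> 0 -> formal_solution q p lambda G ->
       exists! xi : R[i], xi ^+ 20 = 1 /\
         exists (n : nat) (c : R[i]),
           lambda * p ^+ n = xi * s^-1 /\
           G = c *: iter n (@fps_mulz R[i]) (F xi)).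
Proof.
have s_neq0 : s != 0.
  by apply: contraTneq hq => s0; rewrite -hs s0 expr0n normr0 ltxx.
have p_neq0 : p != 0 by rewrite hp expf_neq0.
have qE : q = p ^+ 20 by rewrite hp -exprM hs.
(* [p] is not a root of unity, since [q = p ^+ 20] has norm below 1. *)
have pn_neq1 n : (0 < n)%N -> (p ^+ n) ^+ 20 != 1.
  move=> n_gt0; rewrite exprAC -qE; apply: contraTneq hq => qn1.
  have := congr1 Num.norm qn1; rewrite normrX normr1 => qn_norm.
  apply/negP => /andP[q_gt0 q_lt1].
  by move: q_lt1; rewrite -(expr_lt1 n_gt0 (ltW q_gt0)) qn_norm ltxx.
(* The parameters [lambda] for which a solution can start at exponent 0. *)
pose exceptional (mu : R[i]) := mu ^+ 20 * p ^+ 10 = 1.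
have exc_neq0 mu n : exceptional mu -> (0 < n)%N -> indicial p mu n != 0.
  by move=> mu1 n_gt0; apply: indicial_neq0 => //; exact: pn_neq1.
have tri mu : triangular (indicial p mu) (recurrence_op p mu).
  exact: triangular_recurrence.
have unity_neq0 (xi : R[i]) : xi ^+ 20 = 1 -> xi != 0.
  by move=> xi1; apply: contra_eq_neq xi1 => ->; rewrite expr0n eq_sym oner_neq0.
have exc_root xi : xi ^+ 20 = 1 -> exceptional (xi / s).
  move=> xi1; rewrite /exceptional hp -exprM exprMn xi1 mul1r -exprMn.
  by rewrite mulVf ?expr1n.
(* The normalisation [F 0 = 1] makes the series nonzero and fixes its
   valuation. *)
have /choice[F FP] xi : exists F : fps R[i], xi ^+ 20 = 1 ->
    F 0%N = 1 /\ recurrence_op p (xi / s) F = 0.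
  have [xi1|nxi1] := pselect (xi ^+ 20 = 1); last by exists 0.
  have exc_xi := exc_root xi xi1.
  have [||F FP] := triangular_solution (tri (xi / s)); last by exists F.
    have xi_neq0 : xi / s != 0 by rewrite mulf_neq0 ?invr_eq0 ?(unity_neq0 xi).
    by apply/eqP; rewrite indicial_eq0 //; exact/eqP.
  by move=> n; exact: exc_neq0.
exists F; split=> [xi xi1|lambda G lambda_neq0 G_neq0].
  have [F0 solF] := FP xi xi1; split.
  - by move=> Fxi0; move: F0; rewrite Fxi0 => /esym/eqP; rewrite oner_eq0.
  - by apply/(formal_solution_recurrence _ p_neq0 _ qE).
  - by rewrite (series_op_recurrence _ _ s_neq0) -hp.
move/(formal_solution_recurrence _ p_neq0 _ qE).
have [n [H [GE H0]]] := fps_valuation G_neq0.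
rewrite GE (recurrence_op_mulz _ _ _ p_neq0) => solH.
have {}solH : recurrence_op p (lambda * p ^+ n) H = 0.
  apply/funext => m; have := congr1 (@^~ (m + n)%N) solH.
  by rewrite /= iter_mulzE leq_addl addnK.
have mu_neq0 : lambda * p ^+ n != 0 by rewrite mulf_neq0 ?expf_neq0 //; exact/eqP.
have lambda_exc : exceptional (lambda * p ^+ n).
  have := triangular_head (F := H) (n := 0) (tri (lambda * p ^+ n)).
  rewrite solH => /(_ (fun _ => False_ind _ \o notF))/esym/eqP.
  by rewrite mulf_eq0 (negbTE H0) orbF indicial_eq0 // => /eqP.
(* Forced by the condition [lambda * p ^+ n = xi / s]. *)
pose xi := lambda * p ^+ n * s.
have xi1 : xi ^+ 20 = 1 by rewrite exprMn -lambda_exc hp -!exprM.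
have xiE : lambda * p ^+ n = xi / s by rewrite mulfK.
have [F0 solF] := FP xi xi1.
have HE : H = H 0%N *: F xi.
  apply: (triangular_inj (tri (xi / s))).
  - by move=> m; exact/exc_neq0/exc_root.
  - by rewrite (triangularZ (tri _)) solF scaler0 -xiE.
  - by rewrite -[RHS]/(H 0%N * F xi 0%N) F0 mulr1.
exists xi; split=> [|xi' [xi'1 [n' [c [lambdaE eqF]]]]].
  by split=> //; exists n, (H 0%N); rewrite iter_mulzZ -HE.
have [F'0 _] := FP xi' xi'1.
have c_neq0 : c != 0.
  by apply/eqP => c0; apply: G_neq0; rewrite GE eqF c0 scale0r.
have nE : n = n'.
  apply: (valuation_inj H0 (G := c *: F xi')); last by rewrite -iter_mulzZ.
  by rewrite -[_ 0%N]/(c * F xi' 0%N) F'0 mulr1.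
by rewrite /xi nE lambdaE mulfVK.
Qed.
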